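(* Let $V_I, V_O:\mathbb{R}\to\mathbb{C}$ and $r\in\mathbb{C}$. Put $a_0 = 3906249999.75586$, $a_1 = 62500.0000039063$, $b_0 = 7812500000.48828$ (exact decimal real numbers). Assume: (A1) $V_I$ is differentiable at every $t\in\mathbb{R}$ (the order-$0$ higher-derivative differentiability condition for $V_I$ holds at every $t$); (A2) $V_O$, $V_O'$ and $V_O''$ are differentiable at every $t\in\mathbb{R}$ (the order-$2$ higher-derivative differentiability condition for $V_O$ holds at every $t$); (A3) $V_O(0)=0$ and $V_O'(0)=0$; (A4) for all $s\in\mathbb{C}$ with $\operatorname{Re} r\le \operatorname{Re} s$, $s^2 + a_1 s + a_0\neq 0$; (A5) for all $s$ with $\operatorname{Re} r\le\operatorname{Re} s$, $\mathcal{L}[V_I](s)\neq 0$; (A6) $0<\operatorname{Re} r$; (A7) for all $s$ with $\operatorname{Re} r\le\operatorname{Re} s$, the Laplace transform of $V_I$ exists at $s$; (A8) for all $s$ with $\operatorname{Re} r\le\operatorname{Re} s$, the Laplace transforms of $V_O$, $V_O'$, $V_O''$ exist at $s$; (A9) for all $s$ with $\operatorname{Re} r\le\operatorname{Re} s$, $\dfrac{\mathcal{L}[V_O](s)}{\mathcal{L}[V_I](s)} = \dfrac{b_0}{s^2 + a_1 s + a_0}$. Then for all $t\ge 0$, $a_0 V_O(t) + a_1 V_O'(t) + V_O''(t) = b_0 V_I(t)$.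
   Context: All functions are complex-valued functions of a real variable $t$; derivatives are with respect to $t$. The Laplace transform is $\mathcal{L}[f](s)=\int_{\{t\,:\,0\le t\}} e^{-st} f(t)\,dt$ for $s\in\mathbb{C}$. ''The Laplace transform of $f$ exists at $s$'' means: $f$ is piecewise differentiable on $[0,b]$ for every $b$, and there exist $M>0$ and a real $a$ with $\operatorname{Re}s>a$ such that $|f(t)|\le M e^{a t}$ for all $t\ge 0$. The conclusion is the order-$2$ linear differential equation with output coefficient list $(a_0,a_1,1)$ and input coefficient list $(b_0)$, modelling a Sallen-key low-pass filter. *)

(* Defs.v *)
From Stdlib Require Import Reals List.
From Coquelicot Require Export Coquelicot.
Open Scope R_scope.

Definition Cexp (z : C) : C :=
  (exp (Re z) * cos (Im z), exp (Re z) * sin (Im z)).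

Definition Cdifferentiable (f : R -> C) (t : R) : Prop :=
  ex_derive (K := R_AbsRing) (V := C_R_NormedModule) f t.

(* Coquelicot's [Derive] is restricted to real-valued functions. *)
Definition Cderive (f : R -> C) (t : R) : C :=
  (Derive (fun u => Re (f u)) t, Derive (fun u => Im (f u)) t).

Lemma Cderive_correct (f : R -> C) (t : R) :
  Cdifferentiable f t ->
  is_derive (K := R_AbsRing) (V := C_R_NormedModule) f t (Cderive f t).
Proof.
intros [l Hl].
replace (Cderive f t) with l; [exact Hl|].
assert (H1 : is_derive (fun u => Re (f u)) t (fst l)).
{ apply (filterdiff_comp' (V := C_R_NormedModule) (W := R_NormedModule)
           f (@fst R R) t _ (@fst R R) Hl).
  apply filterdiff_linear.
  exact (is_linear_fst (U := R_NormedModule) (V := R_NormedModule)). }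
assert (H2 : is_derive (fun u => Im (f u)) t (snd l)).
{ apply (filterdiff_comp' (V := C_R_NormedModule) (W := R_NormedModule)
           f (@snd R R) t _ (@snd R R) Hl).
  apply filterdiff_linear.
  exact (is_linear_snd (U := R_NormedModule) (V := R_NormedModule)). }
apply is_derive_unique in H1, H2.
rewrite (surjective_pairing l).
exact (eq_sym (f_equal2 pair H1 H2)).
Qed.

(* The integral over {t | 0 <= t}, taken as an improper Riemann integral of
   C-valued functions; like every [RInt_gen] it is a junk value when the
   integral does not converge. *)
Definition laplace (f : R -> C) (s : C) : C :=
  RInt_gen (V := C_R_CompleteNormedModule)
    (fun t : R => (Cexp (- s * t) * f t)%C)
    (at_point 0) (Rbar_locally p_infty).

(* Continuity at the end points is relative to the interval, while
   differentiability is two-sided, off a finite set of exceptional points. *)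
Definition piecewise_differentiable_on (f : R -> C) (a b : R) : Prop :=
  continuous_on (T := R_UniformSpace) (U := C_UniformSpace)
    (fun t => a <= t <= b) f /\
  exists exc : list R,
    forall t, a <= t <= b -> ~ In t exc -> Cdifferentiable f t.

Definition exp_order (f : R -> C) (M a : R) : Prop :=
  0 < M /\ forall t, 0 <= t -> Cmod (f t) <= M * exp (a * t).

Definition laplace_exists (f : R -> C) (s : C) : Prop :=
  (forall b, piecewise_differentiable_on f 0 b) /\
  exists M a : R, a < Re s /\ exp_order f M a.

Definition sk_a0 : R := 3906249999.75586.
Definition sk_a1 : R := 62500.0000039063.
Definition sk_b0 : R := 7812500000.48828.

(* Main.v *)
(** Zero initial data turn [d/dt] into multiplication by [s], so the transfer
    equation says that [sum_k c_k y^(k) - sum_k d_k u^(k)] has zero Laplace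
    transform on a half plane, and Lerch's theorem makes it vanish on [[0, +oo)].

    For Lerch's theorem let [h(t)] be the real or imaginary part of
    [exp(-st) f(t)], where the transform of [f] vanishes at all points [s + n].
    Then [h] is orthogonal to every [exp(-nt)], hence to all powers of the Landau
    kernel [1 - (exp(-t) - exp(-t0))^2], which lies in [[0, 1]] and is maximal
    exactly at [t0]. If [h t0 > 0], the mass of a high power near [t0] beats the
    contribution of the set where [h] is negative, and the integral of that power
    against [h] cannot be zero. *)

Require Import Defs.
From Stdlib Require Import Reals Lra List.
From Coquelicot Require Import Coquelicot.
Import ListNotations.
Open Scope R_scope.

Lemma is_RInt_gen_ext_eq {V : NormedModule R_AbsRing} {Fa Fb : (R -> Prop) -> Prop}
    {FFa : Filter Fa} {FFb : Filter Fb} (f g : R -> V) (l : V) :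
  (forall t, f t = g t) -> is_RInt_gen f Fa Fb l -> is_RInt_gen g Fa Fb l.
Proof. intros Hfg. apply is_RInt_gen_ext, filter_forall. auto. Qed.

Lemma Riemann_sum_linear {U V : NormedModule R_AbsRing} (l : U -> V) (f : R -> U) (ptd : SF_seq) :
  is_linear l -> Riemann_sum (fun t => l (f t)) ptd = l (Riemann_sum f ptd).
Proof.
intros Hl. induction ptd as [x0|h ptd IH] using SF_cons_ind.
- symmetry. exact (linear_zero l Hl).
- rewrite !Riemann_sum_cons, (linear_plus l Hl), (linear_scal l Hl), IH. reflexivity.
Qed.

Lemma is_RInt_linear {U V : NormedModule R_AbsRing} (l : U -> V) (f : R -> U) (a b : R) (I : U) :
  is_linear l -> is_RInt f a b I -> is_RInt (fun t => l (f t)) a b (l I).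
Proof.
intros Hl Hf. unfold is_RInt.
apply filterlim_ext with (fun ptd => l (scal (sign (b - a)) (Riemann_sum f ptd))).
- intros ptd. rewrite (linear_scal l Hl), (Riemann_sum_linear l f ptd Hl). reflexivity.
- eapply filterlim_comp; [exact Hf|exact (linear_cont l I Hl)].
Qed.

Lemma is_RInt_gen_linear {U V : NormedModule R_AbsRing} {Fa Fb : (R -> Prop) -> Prop}
    {FFa : Filter Fa} {FFb : Filter Fb} (l : U -> V) (f : R -> U) (I : U) :
  is_linear l -> is_RInt_gen f Fa Fb I -> is_RInt_gen (fun t => l (f t)) Fa Fb (l I).
Proof.
intros Hl Hf P HP.
apply (filter_imp (F := filter_prod Fa Fb)) with (2 := Hf _ (linear_cont l I Hl P HP)).
intros ab [y [Hy HPy]]. exists (l y). split; [now apply is_RInt_linear|exact HPy].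
Qed.

Lemma is_RInt_gen_infty_iff {V : CompleteNormedModule R_AbsRing} (f : R -> V) (a : R) (l : V) :
  is_RInt_gen f (at_point a) (Rbar_locally p_infty) l <->
  (forall b, a <= b -> ex_RInt f a b) /\
  filterlim (fun b => RInt f a b) (Rbar_locally p_infty) (locally l).
Proof.
split.
- intros Hf. split.
  + intros b Hb.
    destruct (Hf (fun _ => True) filter_true) as [Q S HQ [B HB] HQS].
    destruct (HQS a (Rmax b (B + 1)) HQ) as [y [Hy _]].
    { apply HB. pose proof (Rmax_r b (B + 1)). lra. }
    apply (ex_RInt_Chasles_1 f a b (Rmax b (B + 1))); [|now exists y].
    split; [exact Hb|apply Rmax_l].
  + intros P HP. destruct (Hf P HP) as [Q S HQ HS HQS].
    refine (filter_imp (F := Rbar_locally p_infty) S _ _ HS).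
    intros b Hb. destruct (HQS a b HQ Hb) as [y [Hy HPy]].
    rewrite (is_RInt_unique f a b y Hy). exact HPy.
- intros [Hex Hlim] P HP.
  apply (Filter_prod _ _ _ (fun u => u = a) (fun b => a < b /\ P (RInt f a b))).
  + reflexivity.
  + apply filter_and; [now exists a|exact (Hlim P HP)].
  + intros u b -> [Hb HPb]. exists (RInt f a b). split; [|exact HPb].
    apply RInt_correct, Hex. lra.
Qed.

Lemma is_RInt_minus_left {V : CompleteNormedModule R_AbsRing} (f : R -> V) (a u v : R) :
  (forall b, a <= b -> ex_RInt f a b) -> a <= u <= v ->
  is_RInt f u v (minus (RInt f a v) (RInt f a u)).
Proof.
intros Hf Huv. unfold minus. rewrite plus_comm.
apply (is_RInt_Chasles (V := V) f u a v);
  [apply (is_RInt_swap (V := V))|]; apply (RInt_correct (V := V)), Hf; lra.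
Qed.

Lemma ex_RInt_gen_infty_le {V : CompleteNormedModule R_AbsRing} (f : R -> V) (g : R -> R) (a : R) :
  (forall b, a <= b -> ex_RInt f a b) -> (forall t, a <= t -> norm (f t) <= g t) ->
  ex_RInt_gen g (at_point a) (Rbar_locally p_infty) ->
  ex_RInt_gen f (at_point a) (Rbar_locally p_infty).
Proof.
intros Hf Hfg [G HG].
apply (is_RInt_gen_infty_iff (V := R_CompleteNormedModule)) in HG. destruct HG as [Hg Hlim].
assert (Hfg_int : forall u v, a <= u <= v ->
  norm (minus (RInt f a v) (RInt f a u)) <= minus (RInt g a v) (RInt g a u)).
{ intros u v Huv. apply (norm_RInt_le f g u v); [lra| |now apply is_RInt_minus_left|].
  - intros t Ht. apply Hfg. lra.
  - now apply (is_RInt_minus_left (V := R_CompleteNormedModule)). }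
assert (Hcauchy : exists l : V, filterlim (fun b => RInt f a b) (Rbar_locally p_infty) (locally l)).
{ apply (filterlim_locally_cauchy (U := V) (F := Rbar_locally p_infty)). intros eps.
  destruct (proj2 (filterlim_locally_cauchy (U := R_CompleteNormedModule)
    (F := Rbar_locally p_infty) _) (ex_intro _ G Hlim) eps) as [P [HP HPeps]].
  exists (fun b => a < b /\ P b). split.
  { apply filter_and; [now exists a|exact HP]. }
  assert (Hordered : forall u v, a < u -> u <= v -> P u -> P v ->
    ball (RInt f a u) eps (RInt f a v)).
  { intros u v Hu Huv Pu Pv. apply (norm_compat1 (V := V)).
    eapply Rle_lt_trans; [apply Hfg_int; lra|].
    eapply Rle_lt_trans; [apply Rle_abs|exact (HPeps u v Pu Pv)]. }
  intros u v [Hu Pu] [Hv Pv]. destruct (Rle_dec u v) as [Huv|Huv].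
  - now apply Hordered.
  - apply ball_sym, Hordered; auto; lra. }
destruct Hcauchy as [l Hl]. exists l. apply is_RInt_gen_infty_iff. now split.
Qed.

Lemma is_RInt_gen_infty_derive {V : CompleteNormedModule R_AbsRing} (f df : R -> V)
    (a : R) (L : V) :
  (forall t, a <= t -> is_derive f t (df t)) -> (forall t, a <= t -> continuous df t) ->
  filterlim f (Rbar_locally p_infty) (locally L) ->
  is_RInt_gen df (at_point a) (Rbar_locally p_infty) (minus L (f a)).
Proof.
intros Hder Hcont Hlim.
assert (Hint : forall b, a <= b -> is_RInt df a b (minus (f b) (f a))).
{ intros b Hb. rewrite <- (Rmin_left a b Hb) in Hder, Hcont.
  apply is_RInt_derive; intros t Ht; [apply Hder|apply Hcont]; tauto. }
apply is_RInt_gen_infty_iff. split.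
- intros b Hb. eexists. now apply Hint.
- apply filterlim_ext_loc with (fun b => minus (f b) (f a)).
  + exists a. intros b Hb. symmetry. apply is_RInt_unique, Hint. lra.
  + apply (filterlim_comp_2 (H := locally (opp (f a)))) with (2 := filterlim_const _) (1 := Hlim).
    exact (filterlim_plus (V := V) L (opp (f a))).
Qed.

Lemma is_RInt_gen_infty_ge (f : R -> R) (a u v y l : R) : a <= u <= v ->
  (forall t, a <= t -> 0 <= f t) -> (forall t, u <= t <= v -> y <= f t) ->
  is_RInt_gen f (at_point a) (Rbar_locally p_infty) l -> y * (v - u) <= l.
Proof.
intros Huv Hpos Hge Hf.
apply (is_RInt_gen_infty_iff (V := R_CompleteNormedModule)) in Hf. destruct Hf as [Hex Hlim].
apply (filterlim_le (F := Rbar_locally p_infty) (fun _ => y * (v - u)) (fun b => RInt f a b)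
  (y * (v - u)) l); [|apply filterlim_const|exact Hlim].
exists v. intros b Hb.
assert (Hex_sub : forall c d, a <= c <= d -> ex_RInt f c d).
{ intros c d Hcd. apply (ex_RInt_Chasles_2 f a); [lra|apply Hex; lra]. }
rewrite <- (RInt_Chasles f a u b), <- (RInt_Chasles f u v b) by (apply Hex_sub; lra).
assert (Hbefore : 0 <= RInt f a u).
{ apply RInt_ge_0; [lra|apply Hex_sub; lra|]. intros t Ht. apply Hpos. lra. }
assert (Hafter : 0 <= RInt f v b).
{ apply RInt_ge_0; [lra|apply Hex_sub; lra|]. intros t Ht. apply Hpos. lra. }
assert (Hmid : y * (v - u) <= RInt f u v).
{ replace (y * (v - u)) with (RInt (fun _ => y) u v)
    by (rewrite RInt_const; apply Rmult_comm).
  apply RInt_le; [lra|apply ex_RInt_const|apply Hex_sub; lra|].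
  intros t Ht. apply Hge. lra. }
unfold plus; simpl. lra.
Qed.

Lemma exp_nondecreasing (x y : R) : x <= y -> exp x <= exp y.
Proof. intros [H| ->]; [now apply Rlt_le, exp_increasing|apply Rle_refl]. Qed.

Lemma filterlim_scal_exp_opp_infty (K d : R) : 0 < d ->
  filterlim (fun t => K * exp (- (d * t))) (Rbar_locally p_infty) (locally 0).
Proof.
intros Hd. rewrite <- (Rmult_0_r K).
apply (filterlim_comp _ _ _ (fun t => exp (- (d * t))) (Rmult K) _ (locally 0));
  [|apply (filterlim_scal_r (V := R_NormedModule) K 0)].
apply (is_lim_comp exp (fun t => - (d * t)) p_infty 0 m_infty).
- apply is_lim_exp_m.
- evar_last; [apply is_lim_opp, is_lim_scal_l, is_lim_id|].
  simpl. destruct (Rle_dec 0 d) as [H|]; [|exfalso; lra].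
  destruct (Rle_lt_or_eq_dec 0 d H); [reflexivity|exfalso; lra].
- exists 0. discriminate.
Qed.

Lemma ex_RInt_gen_exp_opp (K d : R) : 0 < d ->
  ex_RInt_gen (fun t => K * exp (- (d * t))) (at_point 0) (Rbar_locally p_infty).
Proof.
intros Hd. eexists.
apply (is_RInt_gen_infty_derive (V := R_CompleteNormedModule)
  (fun t => - K / d * exp (- (d * t))) _ 0 0).
- intros t _. auto_derive; [trivial|field; lra].
- intros t _. apply (ex_derive_continuous (fun t => K * exp (- (d * t)))). auto_derive. trivial.
- now apply filterlim_scal_exp_opp_infty.
Qed.

Lemma exists_pow_mult_lt (p q x y : R) : 0 < q < p -> 0 < x ->
  exists m : nat, q ^ m * y < p ^ m * x.
Proof.
intros Hqp Hx.
assert (Hratio : 1 < p / q) by (apply Rlt_div_r; lra).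
destruct (Pow_x_infinity (p / q) ltac:(rewrite Rabs_pos_eq; lra) (y / x + 1)) as [m Hm].
exists m. specialize (Hm m (Nat.le_refl m)).
rewrite Rabs_pos_eq in Hm by (apply pow_le; lra).
assert (Hqm := pow_lt q m (proj1 Hqp)).
replace p with (p / q * q) by (field; lra).
rewrite Rpow_mult_distr, (Rmult_comm _ (q ^ m)), Rmult_assoc.
apply Rmult_lt_compat_l; [exact Hqm|].
apply Rlt_div_l; lra.
Qed.

(* Where [h] is negative, [phi ^ m] is at most [q ^ m], so adding [q ^ m * Rabs (h t)] to the
   integrand makes it nonnegative while changing the integral by much less than [p ^ m]. *)
Lemma exists_pow_peak_RInt_gen_pos (h phi : R -> R) (q p eps a u v : R) :
  ex_RInt_gen (fun t => Rabs (h t)) (at_point a) (Rbar_locally p_infty) ->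
  0 < q < p -> 0 < eps -> a <= u < v ->
  (forall t, a <= t -> 0 <= phi t) ->
  (forall t, a <= t -> h t < 0 -> phi t <= q) ->
  (forall t, u <= t <= v -> p <= phi t /\ eps <= h t) ->
  exists m : nat, forall l,
    is_RInt_gen (fun t => phi t ^ m * h t) (at_point a) (Rbar_locally p_infty) l -> 0 < l.
Proof.
intros [I HI] Hqp Heps Huv Hphi Hneg Hpeak.
destruct (exists_pow_mult_lt p q (eps * (v - u)) I Hqp) as [m Hm]; [nra|].
exists m. intros l Hl.
assert (Hqm := pow_lt q m (proj1 Hqp)).
assert (Hcorrected : p ^ m * eps * (v - u) <= l + q ^ m * I); [|lra].
apply (is_RInt_gen_infty_ge (fun t => phi t ^ m * h t + q ^ m * Rabs (h t)) a u v).
- lra.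
- intros t Ht. assert (Hphim := pow_le _ m (Hphi t Ht)).
  destruct (Rlt_le_dec (h t) 0) as [Hht|Hht].
  + assert (Hle : phi t ^ m <= q ^ m) by (apply pow_incr; auto).
    rewrite (Rabs_left _ Hht). nra.
  + rewrite (Rabs_pos_eq _ Hht). nra.
- intros t Ht. destruct (Hpeak t Ht) as [Hp Hh].
  assert (Hle : p ^ m <= phi t ^ m) by (apply pow_incr; lra).
  assert (Hpm := pow_lt p m ltac:(lra)).
  rewrite Rabs_pos_eq by lra. nra.
- apply (is_RInt_gen_plus (V := R_NormedModule)); [exact Hl|].
  now apply (is_RInt_gen_scal (V := R_NormedModule)).
Qed.

Definition landau (t0 t : R) : R := 1 - (exp (- t) - exp (- t0)) ^ 2.

Lemma landau_pos (t0 t : R) : 0 <= t0 -> 0 <= t -> 0 < landau t0 t.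
Proof.
assert (Hexp : forall x, 0 <= x -> 0 < exp (- x) <= 1).
{ intros x Hx. split; [apply exp_pos|]. rewrite <- exp_0. apply exp_nondecreasing. lra. }
intros Ht0 Ht. apply Hexp in Ht0, Ht. unfold landau. nra.
Qed.

Lemma landau_decreasing (t0 u v : R) : t0 <= u -> u < v -> landau t0 v < landau t0 u.
Proof.
intros Hu Huv. unfold landau.
assert (exp (- v) < exp (- u)) by (apply exp_increasing; lra).
assert (exp (- u) <= exp (- t0)) by (apply exp_nondecreasing; lra).
nra.
Qed.

(* The map [t |-> exp (- t)] is steeper on the left of [t0], so the value on the right bounds both
   sides. *)
Lemma landau_far_le (t0 t del : R) : 0 <= del -> del <= Rabs (t - t0) ->
  landau t0 t <= landau t0 (t0 + del).
Proof.
intros Hdel Ht.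
assert (Hright : exp (- (t0 + del)) = exp (- t0) * exp (- del))
  by (rewrite <- exp_plus; f_equal; ring).
assert (Hdecr : exp (- del) <= 1) by (rewrite <- exp_0; apply exp_nondecreasing; lra).
assert (Hx0 := exp_pos (- t0)).
assert (Hgap : 0 <= exp (- t0) - exp (- (t0 + del)) <= Rabs (exp (- t) - exp (- t0))).
{ rewrite Hright. split; [nra|].
  destruct (Rle_lt_dec t0 t) as [Hside|Hside].
  - rewrite Rabs_pos_eq in Ht by lra.
    rewrite Rabs_minus_sym, <- Hright.
    eapply Rle_trans; [|apply Rle_abs].
    assert (exp (- t) <= exp (- (t0 + del))) by (apply exp_nondecreasing; lra). lra.
  - rewrite Rabs_left in Ht by lra.
    eapply Rle_trans; [|apply Rle_abs].
    assert (Hleft : exp (- t0) * exp del <= exp (- t))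
      by (rewrite <- exp_plus; apply exp_nondecreasing; lra).
    assert (Hup := exp_ineq1_le del). assert (Hdown := exp_ineq1_le (- del)). nra. }
unfold landau. rewrite <- (pow2_abs (exp (- t) - _)). nra.
Qed.

Lemma is_RInt_gen_landau_pow_mult_0 (h : R -> R) (t0 : R) (Fa Fb : (R -> Prop) -> Prop)
    {FFa : Filter Fa} {FFb : Filter Fb} :
  (forall n : nat, is_RInt_gen (fun t => exp (- (INR n * t)) * h t) Fa Fb 0) ->
  forall m n : nat,
    is_RInt_gen (fun t => exp (- (INR n * t)) * (landau t0 t ^ m * h t)) Fa Fb 0.
Proof.
intros Hmom m. induction m as [|m IH]; intros n.
- eapply is_RInt_gen_ext_eq; [|apply (Hmom n)]. intros t. simpl. ring.
- set (F := fun k t => exp (- (INR k * t)) * (landau t0 t ^ m * h t)).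
  set (x := exp (- t0)).
  apply is_RInt_gen_ext_eq with
    (fun t => plus (plus (scal (1 - x ^ 2) (F n t)) (scal (2 * x) (F (S n) t)))
                   (scal (-1) (F (S (S n)) t))).
  + intros t. unfold F. rewrite !S_INR.
    assert (Hlandau : landau t0 t = 1 - x ^ 2 + 2 * x * exp (- t) - exp (- t) ^ 2)
      by (unfold landau; fold x; ring).
    rewrite <- (tech_pow_Rmult (landau t0 t)). set (L := landau t0 t ^ m). rewrite Hlandau.
    replace (- ((INR n + 1 + 1) * t)) with (- (INR n * t) + - t + - t) by ring.
    replace (- ((INR n + 1) * t)) with (- (INR n * t) + - t) by ring.
    rewrite !exp_plus. unfold plus, scal; simpl; unfold mult; simpl. ring.
  + assert (Hzero : 0 = plus (plus (scal (1 - x ^ 2) 0) (scal (2 * x) 0)) (scal (-1) 0))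
      by (unfold plus, scal; simpl; unfold mult; simpl; ring).
    rewrite Hzero at 1.
    apply (is_RInt_gen_plus (V := R_NormedModule));
      [apply (is_RInt_gen_plus (V := R_NormedModule))|];
      apply (is_RInt_gen_scal (V := R_NormedModule)), IH.
Qed.

Lemma exp_moments_0_nonpos (h : R -> R) (t0 : R) : 0 <= t0 -> continuous h t0 ->
  ex_RInt_gen (fun t => Rabs (h t)) (at_point 0) (Rbar_locally p_infty) ->
  (forall n : nat,
    is_RInt_gen (fun t => exp (- (INR n * t)) * h t) (at_point 0) (Rbar_locally p_infty) 0) ->
  h t0 <= 0.
Proof.
intros Ht0 Hcont Habs Hmom.
destruct (Rle_lt_dec (h t0) 0) as [|Hpos]; [assumption|exfalso].
assert (Heps : 0 < h t0 / 2) by lra.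
destruct (proj1 (filterlim_locally _ _) Hcont (mkposreal _ Heps)) as [del Hdel].
assert (Hnear : forall t, Rabs (t - t0) < del -> h t0 / 2 <= h t).
{ intros t Ht. specialize (Hdel t Ht). change (Rabs (h t - h t0) < h t0 / 2) in Hdel.
  apply Rabs_def2 in Hdel. lra. }
assert (Hdel_pos := cond_pos del).
destruct (exists_pow_peak_RInt_gen_pos h (landau t0) (landau t0 (t0 + del))
  (landau t0 (t0 + del / 2)) (h t0 / 2) 0 t0 (t0 + del / 2)) as [m Hm]; trivial.
- split; [apply landau_pos; lra|apply landau_decreasing; lra].
- lra.
- intros t Ht. apply Rlt_le, landau_pos; lra.
- intros t _ Hht. apply landau_far_le; [lra|].
  apply Rnot_lt_le. intros Hlt. specialize (Hnear t Hlt). lra.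
- intros t Ht. split.
  + destruct (Rle_lt_or_eq_dec _ _ (proj2 Ht)) as [Hlt| ->]; [|lra].
    apply Rlt_le, landau_decreasing; lra.
  + apply Hnear. rewrite Rabs_pos_eq; lra.
- apply (Rlt_irrefl 0), Hm.
  eapply is_RInt_gen_ext_eq; [|apply (is_RInt_gen_landau_pow_mult_0 h t0 _ _ Hmom m 0)].
  intros t. simpl. rewrite Rmult_0_l, Ropp_0, exp_0. ring.
Qed.

Lemma exp_moments_0_eq_0 (h : R -> R) (t : R) : 0 <= t -> continuous h t ->
  ex_RInt_gen (fun t => Rabs (h t)) (at_point 0) (Rbar_locally p_infty) ->
  (forall n : nat,
    is_RInt_gen (fun t => exp (- (INR n * t)) * h t) (at_point 0) (Rbar_locally p_infty) 0) ->
  h t = 0.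
Proof.
intros Ht Hcont Habs Hmom.
apply Rle_antisym; [now apply exp_moments_0_nonpos|].
apply Ropp_le_cancel. rewrite Ropp_0.
apply (exp_moments_0_nonpos (fun t => - h t)); trivial.
- now apply (continuous_opp (V := R_NormedModule)).
- revert Habs. apply ex_RInt_gen_ext_eq. intros u. symmetry. apply Rabs_Ropp.
- intros n. rewrite <- Ropp_0 at 2.
  eapply is_RInt_gen_ext_eq; [|apply (is_RInt_gen_opp (V := R_NormedModule)), (Hmom n)].
  intros u. exact (Ropp_mult_distr_r _ _).
Qed.

Lemma is_derive_pair {U V : NormedModule R_AbsRing} (f : R -> U) (g : R -> V) (t : R)
    (df : U) (dg : V) :
  is_derive f t df -> is_derive g t dg ->
  is_derive (V := prod_NormedModule _ U V) (fun u => (f u, g u)) t (df, dg).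
Proof.
intros Hf Hg.
apply (filterdiff_comp_2 f g (fun (x : U) (y : V) => (x, y)) _ _ (fun x y => (x, y)) Hf Hg).
apply filterdiff_linear, is_linear_prod; [apply is_linear_fst|apply is_linear_snd].
Qed.

Lemma is_derive_linear {U V : NormedModule R_AbsRing} (l : U -> V) (f : R -> U) (t : R) (df : U) :
  is_linear l -> is_derive f t df -> is_derive (fun u => l (f u)) t (l df).
Proof.
intros Hl Hf. eapply filterdiff_ext_lin.
- apply (filterdiff_comp' f l t _ l Hf), filterdiff_linear, Hl.
- intros y. exact (linear_scal l Hl y df).
Qed.

Lemma is_linear_Re : is_linear (U := C_R_NormedModule) (V := R_NormedModule) Re.
Proof. exact is_linear_fst. Qed.

Lemma is_linear_Im : is_linear (U := C_R_NormedModule) (V := R_NormedModule) Im.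
Proof. exact is_linear_snd. Qed.

Lemma norm_C_R (z : C) : norm (z : C_R_NormedModule) = Cmod z.
Proof.
unfold norm; simpl. unfold prod_norm, Cmod, norm; simpl. unfold abs; simpl.
rewrite !Rmult_1_r, <- !Rabs_mult, !Rabs_pos_eq by apply Rle_0_sqr. reflexivity.
Qed.

Lemma is_linear_Cmult (w : C) :
  is_linear (U := C_R_NormedModule) (V := C_R_NormedModule) (Cmult w).
Proof.
split.
- intros x y. apply Cmult_plus_distr_l.
- intros k x. rewrite !scal_R_Cmult, !Cmult_assoc, (Cmult_comm w). reflexivity.
- exists (Cmod w + 1). split; [pose proof (Cmod_ge_0 w); lra|].
  intros x. rewrite !norm_C_R, Cmod_mult.
  apply Rmult_le_compat_r; [apply Cmod_ge_0|lra].
Qed.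

Lemma is_derive_Cmult (f g : R -> C) (t : R) (df dg : C) :
  is_derive (V := C_R_NormedModule) f t df -> is_derive (V := C_R_NormedModule) g t dg ->
  is_derive (V := C_R_NormedModule) (fun u => f u * g u)%C t (df * g t + f t * dg)%C.
Proof.
intros Hf Hg.
assert (Hf_re := is_derive_linear _ f t df is_linear_Re Hf).
assert (Hf_im := is_derive_linear _ f t df is_linear_Im Hf).
assert (Hg_re := is_derive_linear _ g t dg is_linear_Re Hg).
assert (Hg_im := is_derive_linear _ g t dg is_linear_Im Hg).
assert (Hmult := fun u v du dv Hu Hv =>
  is_derive_mult (K := R_AbsRing) u v t du dv Hu Hv Rmult_comm).
replace (df * g t + f t * dg)%C with
  ((Re df * Re (g t) + Re (f t) * Re dg) - (Im df * Im (g t) + Im (f t) * Im dg),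
   (Re df * Im (g t) + Re (f t) * Im dg) + (Im df * Re (g t) + Im (f t) * Re dg))
  by (apply injective_projections; simpl; unfold Re, Im; ring).
apply (is_derive_pair (U := R_NormedModule) (V := R_NormedModule)).
- apply (is_derive_minus (V := R_NormedModule)); now apply Hmult.
- apply (is_derive_plus (V := R_NormedModule)); now apply Hmult.
Qed.

Lemma Cexp_plus (z w : C) : Cexp (z + w) = (Cexp z * Cexp w)%C.
Proof.
unfold Cexp. rewrite re_plus, im_plus, exp_plus, cos_plus, sin_plus.
apply injective_projections; simpl; ring.
Qed.

Lemma Cexp_RtoC (x : R) : Cexp x = exp x.
Proof.
unfold Cexp. rewrite re_RtoC, im_RtoC, cos_0, sin_0.
apply injective_projections; simpl; ring.
Qed.

Lemma Cmod_Cexp (z : C) : Cmod (Cexp z) = exp (Re z).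
Proof.
unfold Cmod, Cexp; simpl.
replace (_ + _) with (exp (Re z) ^ 2 * (Rsqr (sin (Im z)) + Rsqr (cos (Im z))))
  by (unfold Rsqr; ring).
rewrite sin2_cos2, Rmult_1_r. apply sqrt_pow2, Rlt_le, exp_pos.
Qed.

Lemma is_derive_Cexp_mult (z : C) (t : R) :
  is_derive (V := C_R_NormedModule) (fun u : R => Cexp (z * u)) t (z * Cexp (z * t))%C.
Proof.
unfold Cexp.
replace (z * _)%C with
  (exp (Re (z * t)) * Re z * cos (Im (z * t)) - exp (Re (z * t)) * (Im z * sin (Im (z * t))),
   exp (Re (z * t)) * Re z * sin (Im (z * t)) + exp (Re (z * t)) * (Im z * cos (Im (z * t))))
  by (apply injective_projections; simpl; unfold Re, Im; ring).
apply (is_derive_pair (U := R_NormedModule) (V := R_NormedModule)); rewrite re_scal_r, im_scal_r.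
- apply is_derive_ext with (fun u => exp (Re z * u) * cos (Im z * u)).
  + intros u. now rewrite re_scal_r, im_scal_r.
  + auto_derive; [trivial|ring].
- apply is_derive_ext with (fun u => exp (Re z * u) * sin (Im z * u)).
  + intros u. now rewrite re_scal_r, im_scal_r.
  + auto_derive; [trivial|ring].
Qed.

Lemma continuous_Cmult {T : UniformSpace} (f g : T -> C) (x : T) :
  continuous (U := C_UniformSpace) f x -> continuous (U := C_UniformSpace) g x ->
  continuous (U := C_UniformSpace) (fun y => f y * g y)%C x.
Proof.
intros Hf Hg P HP. apply (continuous_mult (K := C_AbsRing) f g x).
- intros Q HQ. now apply Hf, locally_C.
- intros Q HQ. now apply Hg, locally_C.
- now apply locally_C.
Qed.

Definition laplace_integrand (f : R -> C) (s : C) (t : R) : C := (Cexp (- s * t) * f t)%C.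

Definition is_laplace (f : R -> C) (s l : C) : Prop :=
  is_RInt_gen (V := C_R_NormedModule) (laplace_integrand f s)
    (at_point 0) (Rbar_locally p_infty) l.

Definition laplace_transformable (sigma : R) (f : R -> C) : Prop :=
  (forall t : R, continuous (U := C_UniformSpace) f t) /\
  exists M a : R, a < sigma /\ exp_order f M a.

Lemma continuous_Cdifferentiable (f : R -> C) (t : R) :
  Cdifferentiable f t -> continuous (U := C_UniformSpace) f t.
Proof. exact (ex_derive_continuous (V := C_R_NormedModule) f t). Qed.

Lemma laplace_transformable_of_exists (f : R -> C) (s : C) :
  (forall t, Cdifferentiable f t) -> laplace_exists f s -> laplace_transformable (Re s) f.
Proof. intros Hf [_ Hexp]. split; [intros t; apply continuous_Cdifferentiable, Hf|exact Hexp]. Qed.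

Lemma laplace_transformable_le (sigma tau : R) (f : R -> C) : sigma <= tau ->
  laplace_transformable sigma f -> laplace_transformable tau f.
Proof.
intros Hle [Hcont [M [a [Ha Hexp]]]]. split; [exact Hcont|].
exists M, a. split; [lra|exact Hexp].
Qed.

Lemma exp_order_le_rate (f : R -> C) (M a b : R) : a <= b -> exp_order f M a -> exp_order f M b.
Proof.
intros Hab [HM Hf]. split; [exact HM|]. intros t Ht.
eapply Rle_trans; [exact (Hf t Ht)|].
apply Rmult_le_compat_l; [lra|]. apply exp_nondecreasing. nra.
Qed.

Lemma laplace_transformable_zero (sigma : R) : laplace_transformable sigma (fun _ => RtoC 0).
Proof.
split; [intros t; apply continuous_const|].
exists 1, (sigma - 1). split; [lra|]. split; [lra|].
intros t _. rewrite Cmod_0, Rmult_1_l. apply Rlt_le, exp_pos.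
Qed.

Lemma laplace_transformable_plus (sigma : R) (f g : R -> C) :
  laplace_transformable sigma f -> laplace_transformable sigma g ->
  laplace_transformable sigma (fun t => f t + g t)%C.
Proof.
intros [Hfc [M [a [Ha Hf]]]] [Hgc [N [b [Hb Hg]]]]. split.
- intros t. now apply (continuous_plus (V := C_R_NormedModule)).
- exists (M + N), (Rmax a b). split; [now apply Rmax_lub_lt|].
  destruct (exp_order_le_rate f M a (Rmax a b) (Rmax_l a b) Hf) as [HM Hf'].
  destruct (exp_order_le_rate g N b (Rmax a b) (Rmax_r a b) Hg) as [HN Hg'].
  split; [lra|]. intros t Ht. rewrite Rmult_plus_distr_r.
  eapply Rle_trans; [apply Cmod_triangle|apply Rplus_le_compat; auto].
Qed.

Lemma laplace_transformable_scal (sigma : R) (c : C) (f : R -> C) :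
  laplace_transformable sigma f -> laplace_transformable sigma (fun t => c * f t)%C.
Proof.
intros [Hfc [M [a [Ha [HM Hf]]]]]. split.
- intros t. apply continuous_Cmult; [apply continuous_const|apply Hfc].
- assert (Hc := Cmod_ge_0 c). exists ((Cmod c + 1) * M), a. split; [exact Ha|]. split; [nra|].
  intros t Ht. specialize (Hf t Ht). assert (Hft := Cmod_ge_0 (f t)).
  rewrite Cmod_mult. nra.
Qed.

Lemma continuous_laplace_integrand (f : R -> C) (s : C) (t : R) :
  continuous (U := C_UniformSpace) f t ->
  continuous (U := C_UniformSpace) (laplace_integrand f s) t.
Proof.
apply continuous_Cmult.
apply (ex_derive_continuous (V := C_R_NormedModule) (fun u : R => Cexp (- s * u))).
eexists. apply is_derive_Cexp_mult.
Qed.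

Lemma Cmod_laplace_integrand_le (f : R -> C) (M a : R) (s : C) (t : R) :
  exp_order f M a -> 0 <= t ->
  Cmod (laplace_integrand f s t) <= M * exp (- ((Re s - a) * t)).
Proof.
intros [_ Hf] Ht. unfold laplace_integrand.
rewrite Cmod_mult, Cmod_Cexp, re_scal_r, re_opp.
replace (- ((Re s - a) * t)) with (- Re s * t + a * t) by ring.
rewrite exp_plus, <- Rmult_assoc, (Rmult_comm M), Rmult_assoc.
apply Rmult_le_compat_l; [apply Rlt_le, exp_pos|auto].
Qed.

Lemma is_laplace_laplace (f : R -> C) (s : C) :
  laplace_transformable (Re s) f -> is_laplace f s (laplace f s).
Proof.
intros [Hcont [M [a [Ha Hf]]]].
unfold is_laplace, laplace.
refine (RInt_gen_correct (V := C_R_CompleteNormedModule) _ _).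
apply (ex_RInt_gen_infty_le (V := C_R_CompleteNormedModule) _
  (fun t => M * exp (- ((Re s - a) * t)))).
- intros b _. apply (ex_RInt_continuous (V := C_R_CompleteNormedModule)).
  intros t _. now apply continuous_laplace_integrand.
- intros t Ht. rewrite norm_C_R. now apply Cmod_laplace_integrand_le.
- apply ex_RInt_gen_exp_opp. lra.
Qed.

Lemma filterlim_laplace_integrand (f : R -> C) (s : C) : laplace_transformable (Re s) f ->
  filterlim (laplace_integrand f s) (Rbar_locally p_infty)
    (locally (T := C_UniformSpace) (RtoC 0)).
Proof.
intros [_ [M [a [Ha Hexp]]]].
apply (filterlim_norm_zero (V := C_R_NormedModule)).
apply (filterlim_le_le (fun _ => 0) _ (fun t => M * exp (- ((Re s - a) * t))) 0).
- exists 0. intros t Ht. rewrite norm_C_R. split; [apply Cmod_ge_0|].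
  apply Cmod_laplace_integrand_le; [exact Hexp|lra].
- apply filterlim_const.
- apply filterlim_scal_exp_opp_infty. lra.
Qed.

Lemma is_laplace_zero (s : C) : is_laplace (fun _ => RtoC 0) s 0.
Proof.
assert (H0 := is_laplace_laplace _ s (laplace_transformable_zero (Re s))).
apply (is_RInt_gen_linear _ _ _ (is_linear_Cmult 0)) in H0. rewrite Cmult_0_l in H0.
revert H0. apply is_RInt_gen_ext_eq. intros t.
unfold laplace_integrand. rewrite Cmult_0_r. apply Cmult_0_r.
Qed.

Lemma is_laplace_plus (f g : R -> C) (s lf lg : C) :
  is_laplace f s lf -> is_laplace g s lg -> is_laplace (fun t => f t + g t)%C s (lf + lg)%C.
Proof.
intros Hf Hg. eapply is_RInt_gen_ext_eq;
  [|exact (is_RInt_gen_plus (V := C_R_NormedModule) _ _ _ _ Hf Hg)].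
intros t. symmetry. apply Cmult_plus_distr_l.
Qed.

Lemma is_laplace_scal (c : C) (f : R -> C) (s l : C) :
  is_laplace f s l -> is_laplace (fun t => c * f t)%C s (c * l)%C.
Proof.
intros Hf. eapply is_RInt_gen_ext_eq; [|exact (is_RInt_gen_linear _ _ _ (is_linear_Cmult c) Hf)].
intros t. unfold laplace_integrand. rewrite !Cmult_assoc, (Cmult_comm c). reflexivity.
Qed.

Lemma is_laplace_Cderive (f : R -> C) (s l : C) :
  (forall t, Cdifferentiable f t) -> (forall t, continuous (U := C_UniformSpace) (Cderive f) t) ->
  laplace_transformable (Re s) f -> is_laplace f s l ->
  is_laplace (Cderive f) s (s * l - f 0)%C.
Proof.
intros Hdiff Hcont' Hf_tr Hf.
set (F := laplace_integrand f s) in *.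
set (dF := fun t : R => (- s * F t + laplace_integrand (Cderive f) s t)%C).
assert (Hder : forall t, is_derive (V := C_R_NormedModule) F t (dF t)).
{ intros t. unfold dF, F, laplace_integrand. rewrite Cmult_assoc.
  apply is_derive_Cmult; [apply is_derive_Cexp_mult|apply Cderive_correct, Hdiff]. }
assert (HdF : forall t, continuous (U := C_UniformSpace) dF t).
{ intros t. apply (continuous_plus (V := C_R_NormedModule)).
  - apply continuous_Cmult; [apply continuous_const|apply continuous_laplace_integrand, Hf_tr].
  - now apply continuous_laplace_integrand. }
assert (Hlim := filterlim_laplace_integrand f s Hf_tr).
assert (HF := is_RInt_gen_infty_derive (V := C_R_CompleteNormedModule) F dF 0 (RtoC 0)
  (fun t _ => Hder t) (fun t _ => HdF t) Hlim).
assert (HF0 : F 0 = f 0)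
  by (unfold F, laplace_integrand; rewrite Cmult_0_r, Cexp_RtoC, exp_0; apply Cmult_1_l).
assert (Hsum := is_RInt_gen_plus (V := C_R_NormedModule) _ _ _ _
  (is_RInt_gen_linear _ _ _ (is_linear_Cmult s) Hf) HF).
replace (s * l - f 0)%C with (plus (s * l)%C (minus (RtoC 0) (F 0) : C_R_NormedModule))
  by (rewrite HF0; change ((s * l + (0 + - f 0))%C = (s * l - f 0)%C); ring).
revert Hsum. apply is_RInt_gen_ext_eq. intros t. unfold dF.
change (s * F t + (- s * F t + laplace_integrand (Cderive f) s t) =
  laplace_integrand (Cderive f) s t)%C.
ring.
Qed.

Lemma linear_laplace_integrand_eq_0 (f : R -> C) (s : C) (l : C -> R) (t : R) :
  is_linear (U := C_R_NormedModule) (V := R_NormedModule) l ->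
  laplace_transformable (Re s) f -> (forall n : nat, is_laplace f (s + INR n) 0) ->
  0 <= t -> l (laplace_integrand f s t) = 0.
Proof.
intros Hl [Hcont [M [a [Ha Hexp]]]] Hzero Ht.
assert (Hh : forall u : R, continuous (fun u => l (laplace_integrand f s u)) u).
{ intros u. apply (continuous_comp (laplace_integrand f s) l).
  - now apply continuous_laplace_integrand.
  - exact (linear_cont _ _ Hl). }
apply (exp_moments_0_eq_0 (fun u => l (laplace_integrand f s u)) t Ht (Hh t)).
- destruct (linear_norm _ Hl) as [K [HK Hbound]].
  apply (ex_RInt_gen_infty_le (V := R_CompleteNormedModule) _
    (fun u => K * M * exp (- ((Re s - a) * u)))).
  + intros b _. apply (ex_RInt_continuous (V := R_CompleteNormedModule)).
    intros u _. apply (continuous_comp _ Rabs); [apply Hh|apply continuous_Rabs].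
  + intros u Hu. rewrite Rmult_assoc. change norm with Rabs. rewrite Rabs_Rabsolu.
    eapply Rle_trans; [exact (Hbound (laplace_integrand f s u))|].
    apply Rmult_le_compat_l; [lra|]. rewrite norm_C_R.
    now apply Cmod_laplace_integrand_le.
  + apply ex_RInt_gen_exp_opp. lra.
- intros n. assert (Hmoment := is_RInt_gen_linear _ _ _ Hl (Hzero n)).
  assert (Hl0 : l (RtoC 0) = 0) by exact (linear_zero _ Hl).
  rewrite Hl0 in Hmoment. revert Hmoment. apply is_RInt_gen_ext_eq. intros u.
  unfold laplace_integrand. replace (- (s + INR n) * u)%C with (RtoC (- (INR n * u)) + - s * u)%C
    by (rewrite RtoC_opp, RtoC_mult; ring).
  rewrite Cexp_plus, Cexp_RtoC, <- Cmult_assoc, <- scal_R_Cmult.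
  exact (linear_scal _ Hl _ _).
Qed.

Lemma lerch (f : R -> C) (s : C) (t : R) :
  laplace_transformable (Re s) f -> (forall n : nat, is_laplace f (s + INR n) 0) ->
  0 <= t -> f t = RtoC 0.
Proof.
intros Hf Hzero Ht.
assert (Hw : laplace_integrand f s t = RtoC 0).
{ apply injective_projections.
  - now apply (linear_laplace_integrand_eq_0 f s Re t is_linear_Re).
  - now apply (linear_laplace_integrand_eq_0 f s Im t is_linear_Im). }
apply (f_equal Cmod) in Hw. unfold laplace_integrand in Hw.
rewrite Cmod_mult, Cmod_Cexp, Cmod_0 in Hw.
apply Cmod_eq_0. destruct (Rmult_integral _ _ Hw) as [Hexp|]; [|assumption].
exfalso. exact (Rgt_not_eq _ _ (exp_pos _) Hexp).
Qed.

Fixpoint diff_op (cs : list C) (f : R -> C) (t : R) : C :=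
  match cs with
  | nil => 0
  | c :: cs => (c * f t + diff_op cs (Cderive f) t)%C
  end.

Fixpoint char_poly (cs : list C) (s : C) : C :=
  match cs with
  | nil => 0
  | c :: cs => (c + s * char_poly cs s)%C
  end.

Fixpoint transformable_at_rest (sigma : R) (n : nat) (f : R -> C) : Prop :=
  laplace_transformable sigma f /\
  match n with
  | O => True
  | S n => (forall t, Cdifferentiable f t) /\ f 0 = RtoC 0 /\
      transformable_at_rest sigma n (Cderive f)
  end.

Lemma transformable_at_rest_transformable (sigma : R) (n : nat) (f : R -> C) :
  transformable_at_rest sigma n f -> laplace_transformable sigma f.
Proof. destruct n; intros [Hf _]; exact Hf. Qed.

Lemma transformable_at_rest_O (f : R -> C) (s : C) :
  (forall t, Cdifferentiable f t) -> laplace_exists f s -> transformable_at_rest (Re s) 0 f.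
Proof. intros Hdiff Hex. split; [now apply laplace_transformable_of_exists|exact I]. Qed.

Lemma transformable_at_rest_S (n : nat) (f : R -> C) (s : C) :
  (forall t, Cdifferentiable f t) -> laplace_exists f s -> f 0 = RtoC 0 ->
  transformable_at_rest (Re s) n (Cderive f) -> transformable_at_rest (Re s) (S n) f.
Proof.
intros Hdiff Hex H0 Hf'. split; [now apply laplace_transformable_of_exists|].
exact (conj Hdiff (conj H0 Hf')).
Qed.

Lemma transformable_at_rest_le (sigma tau : R) (n : nat) (f : R -> C) : sigma <= tau ->
  transformable_at_rest sigma n f -> transformable_at_rest tau n f.
Proof.
intros Hle. revert f. induction n as [|n IH]; intros f [Hf Hrest];
  (split; [now apply (laplace_transformable_le sigma)|]).
- exact I.
- destruct Hrest as [Hdiff [H0 Hrest]]. auto.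
Qed.

Lemma laplace_transformable_diff_op (cs : list C) (sigma : R) (n : nat) (f : R -> C) :
  (length cs <= S n)%nat -> transformable_at_rest sigma n f ->
  laplace_transformable sigma (diff_op cs f).
Proof.
revert n f. induction cs as [|c cs IH]; intros n f Hlen Hf; simpl.
- apply laplace_transformable_zero.
- apply laplace_transformable_plus.
  + apply laplace_transformable_scal, (transformable_at_rest_transformable sigma n f Hf).
  + apply le_S_n in Hlen. destruct n as [|n].
    * apply Nat.le_0_r, length_zero_iff_nil in Hlen. subst cs. apply laplace_transformable_zero.
    * apply (IH n); [exact Hlen|apply Hf].
Qed.

Lemma is_laplace_diff_op (cs : list C) (n : nat) (f : R -> C) (s l : C) :
  (length cs <= S n)%nat -> transformable_at_rest (Re s) n f -> is_laplace f s l ->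
  is_laplace (diff_op cs f) s (char_poly cs s * l)%C.
Proof.
revert n f l. induction cs as [|c cs IH]; intros n f l Hlen Hf Hl; simpl.
- rewrite Cmult_0_l. apply is_laplace_zero.
- rewrite Cmult_plus_distr_r. apply is_laplace_plus; [now apply is_laplace_scal|].
  apply le_S_n in Hlen. destruct n as [|n].
  + apply Nat.le_0_r, length_zero_iff_nil in Hlen. subst cs. simpl.
    rewrite Cmult_0_r, Cmult_0_l. apply is_laplace_zero.
  + destruct Hf as [Hf_tr [Hf_diff [Hf0 Hf']]].
    replace (s * char_poly cs s * l)%C with (char_poly cs s * (s * l - f 0))%C
      by (rewrite Hf0; ring).
    apply (IH n); [exact Hlen|exact Hf'|].
    apply is_laplace_Cderive; trivial.
    apply (transformable_at_rest_transformable _ _ _ Hf').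
Qed.

Theorem diff_op_eq_of_laplace (cs ds : list C) (m n : nat) (sigma : R) (f g : R -> C) :
  (length cs <= S m)%nat -> (length ds <= S n)%nat ->
  transformable_at_rest sigma m f -> transformable_at_rest sigma n g ->
  (forall s : C, sigma <= Re s ->
    char_poly cs s * laplace f s = char_poly ds s * laplace g s)%C ->
  forall t, 0 <= t -> diff_op cs f t = diff_op ds g t.
Proof.
intros Hcs Hds Hf Hg Htransfer t Ht.
set (residual := fun t => (diff_op cs f t + - RtoC 1 * diff_op ds g t)%C).
assert (Hlap : forall s : C, sigma <= Re s -> is_laplace residual s 0).
{ intros s Hs. apply (transformable_at_rest_le _ (Re s)) in Hf, Hg; trivial.
  replace (RtoC 0) with
    (char_poly cs s * laplace f s + - RtoC 1 * (char_poly ds s * laplace g s))%C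
    by (rewrite (Htransfer s Hs); ring).
  apply is_laplace_plus;
    [apply (is_laplace_diff_op cs m)|apply is_laplace_scal, (is_laplace_diff_op ds n)]; trivial;
    apply is_laplace_laplace; eapply transformable_at_rest_transformable; eassumption. }
assert (Hresidual : residual t = RtoC 0).
{ apply (lerch residual sigma t); [|intros k|exact Ht].
  - apply laplace_transformable_plus; [|apply laplace_transformable_scal];
      eapply laplace_transformable_diff_op; eassumption.
  - apply Hlap. rewrite re_plus, !re_RtoC. pose proof (pos_INR k). lra. }
replace (diff_op cs f t) with (residual t + diff_op ds g t)%C by (unfold residual; ring).
rewrite Hresidual. apply Cplus_0_l.
Qed.

Theorem theorem2 (VI VO : R -> C) (r : C)
  (A1 : forall t : R, Cdifferentiable VI t)
  (A2 : forall t : R,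
      Cdifferentiable VO t /\
      Cdifferentiable (Cderive VO) t /\
      Cdifferentiable (Cderive (Cderive VO)) t)
  (A3 : VO 0 = RtoC 0 /\ Cderive VO 0 = RtoC 0)
  (A4 : forall s : C, Re r <= Re s ->
      (s ^ 2 + sk_a1 * s + sk_a0)%C <> RtoC 0)
  (A5 : forall s : C, Re r <= Re s -> laplace VI s <> RtoC 0)
  (A6 : 0 < Re r)
  (A7 : forall s : C, Re r <= Re s -> laplace_exists VI s)
  (A8 : forall s : C, Re r <= Re s ->
      laplace_exists VO s /\
      laplace_exists (Cderive VO) s /\
      laplace_exists (Cderive (Cderive VO)) s)
  (A9 : forall s : C, Re r <= Re s ->
      (laplace VO s / laplace VI s)%C =
      (sk_b0 / (s ^ 2 + sk_a1 * s + sk_a0))%C) :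
  forall t : R, 0 <= t ->
    (sk_a0 * VO t + sk_a1 * Cderive VO t + Cderive (Cderive VO) t)%C =
    (sk_b0 * VI t)%C.
Proof.
destruct A3 as [VO_0 VO'_0].
assert (HVI : transformable_at_rest (Re r) 0 VI)
  by exact (transformable_at_rest_O VI r A1 (A7 r (Rle_refl _))).
assert (HVO : transformable_at_rest (Re r) 2 VO).
{ destruct (A8 r (Rle_refl _)) as [HVO_ex [HVO'_ex HVO''_ex]].
  do 2 (apply transformable_at_rest_S; trivial; [apply A2|]).
  apply transformable_at_rest_O; trivial. apply A2. }
assert (Htransfer : forall s, Re r <= Re s ->
  (char_poly [RtoC sk_a0; RtoC sk_a1; RtoC 1] s * laplace VO s)%C =
  (char_poly [RtoC sk_b0] s * laplace VI s)%C).
{ intros s Hs. assert (HP := A4 s Hs). assert (HLI := A5 s Hs).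
  replace (char_poly [RtoC sk_a0; RtoC sk_a1; RtoC 1] s) with (s ^ 2 + sk_a1 * s + sk_a0)%C
    by (simpl; ring).
  replace (laplace VO s) with (laplace VO s / laplace VI s * laplace VI s)%C by (field; exact HLI).
  rewrite (A9 s Hs). set (P := (s ^ 2 + _ + _)%C) in *. simpl. field. exact HP. }
intros t Ht.
apply (diff_op_eq_of_laplace _ _ 2 0 _ VO VI) with (t := t) in Htransfer as Hode; trivial.
simpl in Hode.
replace (sk_b0 * VI t)%C with (sk_b0 * VI t + 0)%C by ring.
rewrite <- Hode. ring.
Qed.
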